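(* Let $p$ be a prime, $N\in\mathbb N$ and $i_1,\dots,i_N\ge0$ with $i_1+\dots+i_N=1$. Then $\dim\mathrm{Bad}_{\mathbb Z_p}(i_1,\dots,i_N)=N$.
   Context: $|\cdot|_p$ is the $p$-adic absolute value, $\mathbb Z_p$ the ring of $p$-adic integers; $\mathbb Z_p^N$ carries the metric $d(x,y)=\max_s|x_s-y_s|_p$ and $\dim$ is Hausdorff dimension with respect to it. $|\cdot|$ is the ordinary absolute value on $\mathbb Z$. $\mathrm{Bad}_{\mathbb Z_p}(i_1,\dots,i_N)$ is the set of $x=(x_1,\dots,x_N)\in\mathbb Z_p^N$ for which there is $c(x)>0$ such that $$\max\{|qx_1-r_1|_p^{1/(1+i_1)},\dots,|qx_N-r_N|_p^{1/(1+i_N)}\}\ \ge\ c(x)\max\{|r_1|,\dots,|r_N|,|q|\}^{-1}$$ for all $(r_1,\dots,r_N)\in\mathbb Z^N$ and $q\in\mathbb Z\setminus\{0\}$. *)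

(* Defs.v *)
From HB Require Import structures.
From mathcomp Require Import all_boot all_order all_algebra.
From mathcomp Require Import all_classical all_reals all_analysis.
Set Implicit Arguments. Unset Strict Implicit. Unset Printing Implicit Defensive.
Import Order.TTheory GRing.Theory Num.Theory.
Local Open Scope classical_set_scope.
Local Open Scope ring_scope.

(* The p-adic integers Z_p, as compatible sequences of residues:
   x n is the residue of x modulo p^n (0 <= x n < p^n), and
   x (n+1) reduces to x n modulo p^n. *)
Definition Zpadic (p : nat) : Type :=
  {x : nat -> nat | forall n, (x n < p ^ n)%N /\ (x n.+1 %% p ^ n)%N = x n}.

Definition zp_res (p : nat) (x : Zpadic p) : nat -> nat := proj1_sig x.
Arguments zp_res {p} x.

(* p-adic absolute value of the p-adic integer whose residue modulo p^n is
   represented by the integer u n (u a compatible sequence):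
   |y|_p = inf { p^-n : p^n divides y }   (= 0 if y = 0). *)
Definition pabs (R : realType) (p : nat) (u : nat -> int) : R :=
  inf [set (p%:R : R) ^- n | n in [set n : nat | (p%:Z ^+ n %| u n)%Z]].

Definition pabs_lin (R : realType) (p : nat) (q : int) (x : Zpadic p) (r : int) : R :=
  pabs R p (fun n => q * (zp_res x n)%:Z - r).
Arguments pabs_lin R p q x r : clear implicits.

Definition pabs_sub (R : realType) (p : nat) (x y : Zpadic p) : R :=
  pabs R p (fun n => (zp_res x n)%:Z - (zp_res y n)%:Z).
Arguments pabs_sub R p x y : clear implicits.

Definition zpN_dist (R : realType) (p N : nat) (x y : 'I_N -> Zpadic p) : R :=
  \big[Num.max/0]_(s < N) pabs_sub R p (x s) (y s).

Section Hausdorff.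
Variables (R : realType) (T : Type) (d : T -> T -> R).
Local Open Scope ereal_scope.

Definition diam (U : set T) : \bar R :=
  ereal_sup [set (d xy.1 xy.2)%:E | xy in U `*` U].

Definition hcost (s : R) (U : set T) : \bar R :=
  if `[< U = set0 >] then 0
  else match diam U with
       | EFin r => (r `^ s)%:E
       | _ => +oo
       end.

Definition hmeas_delta (s delta : R) (E : set T) : \bar R :=
  ereal_inf [set \sum_(0 <= i <oo) hcost s (U i) |
             U in [set U : nat -> set T |
                   E `<=` \bigcup_i U i /\ forall i, diam (U i) <= delta%:E]].

Definition hmeas (s : R) (E : set T) : \bar R :=
  ereal_sup [set hmeas_delta s delta E | delta in [set delta : R | (0 < delta)%R]].

Definition hdim (E : set T) : \bar R :=
  ereal_inf [set s%:E | s in [set s : R | (0 <= s)%R /\ hmeas s E = 0]].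
End Hausdorff.

Definition BadZp (R : realType) (p N : nat) (i : 'I_N -> R) : set ('I_N -> Zpadic p) :=
  [set x | exists2 c : R, 0 < c &
     forall (r : 'I_N -> int) (q : int), q != 0 ->
       \big[Num.max/0]_(s < N) (pabs_lin R p q (x s) (r s) `^ (1 + i s)^-1)
       >= c * (Num.max (\big[Num.max/0]_(s < N) `|r s|) `|q|)%:~R ^-1].
Arguments BadZp R p N i : clear implicits.
Arguments zpN_dist R p N x y : clear implicits.
Arguments hdim R T d E : clear implicits.

(* Main.v *)
Require Import Defs.
From HB Require Import structures.
From mathcomp Require Import all_boot all_order all_algebra.
From mathcomp Require Import all_classical all_reals all_analysis.
From mathcomp Require Import perm zify ring lra.
Import Order.TTheory GRing.Theory Num.Theory.
Local Open Scope classical_set_scope.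
Local Open Scope ring_scope.
Set Implicit Arguments. Unset Strict Implicit. Unset Printing Implicit Defensive.

(* The upper bound is a covering by balls of radius [p^-n]. For the lower bound,
   let [s < N] and suppose that [Bad] is covered by sets with small total
   [s]-cost; each of them lies in a ball of comparable radius [p^-(k d_j)], and
   it suffices to find a point of [Bad] outside all these balls. Such a point is
   the intersection of nested boxes whose sides at level [n] are about
   [p^-((1 + i_l) k (n+1))] in the coordinate [l].
   - The rational points of height at most [p^(k n)] close to a box of level [n]
     lie on one hyperplane (a p-adic simplex lemma), and a hyperplane meets at
     most a proportion [p^-k <= 1/2] of the sub-boxes; avoiding those at every
     level puts the limit point in [Bad].
   - Among the remaining sub-boxes, one is chosen for which the volume occupied
     by the balls, weighted by [2^(d_j - n)], does not increase; if the weighted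
     volume starts below [1], no ball ever swallows a box. The factors [2] are
     harmless because [2 <= p^(k (N - t))] for some [t] in [(s, N)] and [k] large.
   At level [d_j] every box is contained in, or disjoint from, the [j]-th ball. *)

(** * A p-adic simplex lemma *)

(** Multiplication by [T], of determinant 1 or -1, turns column [s] into [q * a s - r s], divisible
    by [p ^ m s]. So [p ^ \sum m s] divides the determinant, which the Leibniz formula bounds by (1
    + N)! H^(1 + N). *)
Lemma det_eq0_of_dvdz (p N H : nat) (a m : 'I_N -> nat) (M : 'M[int]_(1 + N)) :
  ((1 + N)`! * H ^ (1 + N) < p ^ (\sum_s m s))%N ->
  (forall i j, (`|M i j| <= H)%N) ->
  (forall i s, (p%:Z ^+ m s %| M i 0%R * (a s)%:Z - M i (rshift 1 s))%Z) ->
  \det M = 0.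
Proof.
move=> lt_H leM dvdM.
pose T : 'M[int]_(1 + N) :=
  block_mx 1%:M (\row_s (a s)%:Z) 0 (- 1%:M).
pose w : 'rV[int]_(1 + N) := row_mx 1%:M (\row_s p%:Z ^+ m s).
pose Y : 'M[int]_(1 + N) := \matrix_(i, j) ((M *m T) i j %/ w 0%R j)%Z.
have MT : M *m T = Y *m diag_mx w.
  apply/matrixP => i j; rewrite mul_mx_diag [RHS]mxE [Y i j]mxE divzK //.
  case: (split_ordP j) => s ->.
    by rewrite /w row_mxEl !ord1 [X in (X %| _)%Z]mxE dvd1z.
  rewrite /w row_mxEr [X in (X %| _)%Z]mxE.
  have -> : (M *m T) i (rshift 1 s) = M i 0%R * (a s)%:Z - M i (rshift 1 s).
    rewrite mxE big_split_ord big_ord1 /=; congr (_ + _).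
      by rewrite /T block_mxEur mxE; congr (M i _ * _); apply/val_inj.
    rewrite (bigD1 s) //= big1 ?addr0 => [|u su].
      by rewrite /T block_mxEdr !mxE eqxx mulrN mulr1.
    by rewrite /T block_mxEdr !mxE (negbTE su) oppr0 mulr0.
  exact: dvdM.
have dvd_det : (p%:Z ^+ (\sum_s m s) %| \det M)%Z.
  have : (p%:Z ^+ (\sum_s m s) %| \det (M *m T))%Z.
    rewrite MT det_mulmx det_diag big_split_ord /= big_ord1.
    rewrite /w row_mxEl mxE mul1r dvdz_mull //.
    under eq_bigr do rewrite row_mxEr mxE.
    by rewrite prodrXr dvdzz.
  rewrite det_mulmx /T det_ublock det1 mul1r -scaleN1r detZ det1 mulr1.
  by rewrite dvdzE abszM [X in (_ * X)%N]abszX exp1n muln1 -dvdzE.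
apply/eqP; apply: contraTT lt_H => det_neq0; rewrite -leqNgt.
have le_det : (`|\det M| <= (1 + N)`! * H ^ (1 + N))%N.
  rewrite -lez_nat abszE /determinant; apply: le_trans (ler_norm_sum _ _ _) _.
  apply: (@le_trans _ _ (\sum_(s : 'S_(1 + N)) (H ^ (1 + N))%N%:Z)).
    apply: ler_sum => s _; rewrite normrM normrX normrN1 expr1n mul1r.
    rewrite normr_prod -natz natrX -[X in _ ^+ X]card_ord -prodr_const.
    by apply: ler_prod => i _; rewrite normr_ge0 -abszE natz lez_nat leM.
  by rewrite sumr_const card_Sn -mulr_natl PoszM natz.
apply: leq_trans le_det; move: dvd_det; rewrite dvdzE abszX /= => /dvdn_leq -> //.
by rewrite absz_gt0.
Qed.

Lemma int_row_of_rat (n : nat) (v : 'rV[rat]_n) :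
  v != 0 -> exists2 u : 'rV[int]_n, u != 0 & exists c : rat, map_mx intr u = c *: v.
Proof.
move=> v_neq0; pose D := \prod_j denq (v 0 j).
have D_neq0 : D%:~R != 0 :> rat.
  by rewrite intr_eq0; apply/prodf_neq0 => j _; apply: denq_neq0.
pose u : 'rV[int]_n := \row_j (numq (v 0 j) * \prod_(l | l != j) denq (v 0 l)).
have uE : map_mx intr u = D%:~R *: v.
  apply/rowP => j; have -> : D = denq (v 0 j) * \prod_(l | l != j) denq (v 0 l).
    by rewrite /D (bigD1 j).
  by rewrite !mxE !intrM mulrAC [(denq _)%:~R * _]mulrC numqE.
exists u; last by exists D%:~R.
apply: contra_neq v_neq0 => u0; move: uE; rewrite u0 map_mx0 => /esym/eqP.
by rewrite scaler_eq0 (negbTE D_neq0) => /eqP.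
Qed.

(* The box of centre [a] with sides [p^-m s] contains so few rational points
   [r / q] of small height that they all lie on one hyperplane: any [N + 1] of
   the vectors [(q, r)] have a determinant divisible by [p ^ \sum m s] and
   smaller than it. *)
Lemma small_points_hyperplane (p N H : nat) (a m : 'I_N -> nat) :
  ((1 + N)`! * H ^ (1 + N) < p ^ (\sum_s m s))%N ->
  exists2 A : 'rV[int]_(1 + N), A != 0 &
    forall (q : int) (r : 'I_N -> int), (`|q| <= H)%N -> (forall s, `|r s| <= H)%N ->
      (forall s, (p%:Z ^+ m s %| q * (a s)%:Z - r s)%Z) ->
      A 0 0 * q + \sum_s A 0 (rshift 1 s) * r s = 0.
Proof.
move=> lt_H.
(* Vectors with entries in [[-H, H]] are coded by shifting by [H]. The rows of [B] are those
   satisfying the congruences, the others being replaced by 0; no [1 + N] of them are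
   independent. *)
pose F := {ffun 'I_(1 + N) -> 'I_(H.*2.+1)}.
pose vec (f : F) (j : 'I_(1 + N)) : int := (f j)%:Z - H%:Z.
pose V (f : F) := [forall s, (p%:Z ^+ m s %| vec f 0%R * (a s)%:Z - vec f (rshift 1 s))%Z].
pose B : 'M[int]_(#|F|, 1 + N) :=
  \matrix_(i, j) (if V (enum_val i) then vec (enum_val i) j else 0).
pose Bq : 'M[rat]_(#|F|, 1 + N) := map_mx intr B.
have bound x : (x < H.*2.+1)%N -> (`|(x%:Z - H%:Z)%R| <= H)%N by lia.
have not_full : ~~ row_full Bq.
  apply/negP => full; have := fullrowsub_unit full.
  rewrite unitmxE unitfE /Bq -map_mxsub det_map_mx intr_eq0.
  rewrite (det_eq0_of_dvdz lt_H (a := a)) ?eqxx // => i j; rewrite !mxE.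
    case: ifP => // _; rewrite /vec; exact/bound/ltn_ord.
  by case: ifP => [/forallP/(_ j)//|_]; rewrite mul0r subr0 dvdz0.
have [v v_neq0 vB] : exists2 v : 'rV[rat]_(1 + N), v != 0 & v *m Bq^T = 0.
  have : kermx Bq^T != 0.
    rewrite kermx_eq0 /row_free mxrank_tr; exact: not_full.
  by case/rowV0Pn => v /sub_kermxP vB v0; exists v.
have [A A_neq0 [c Ac]] := int_row_of_rat v_neq0.
have AB : A *m B^T = 0.
  have : map_mx intr (A *m B^T) = 0 :> 'rV[rat]_#|F|.
    by rewrite map_mxM -map_trmx Ac -scalemxAl vB scaler0.
  move/rowP => AB0; apply/rowP => j; have := AB0 j; rewrite !mxE => /eqP.
  by rewrite intr_eq0 => /eqP.
exists A => // q r leq ler dvdr.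
pose w (j : 'I_(1 + N)) : int := if fintype.split j is inr s then r s else q.
have wr s : w (rshift 1 s) = r s by rewrite /w (unsplitK (inr s)).
have w0 : w 0 = q by rewrite /w; case: splitP => // k /= /eqP; rewrite add1n.
have lew j : (`|w j| <= H)%N by rewrite /w; case: fintype.split.
have ltw j : (absz (w j + H%:Z)%R < H.*2.+1)%N by have := lew j; lia.
pose f : F := [ffun j => Ordinal (ltw j)].
have vecf j : vec f j = w j by rewrite /vec ffunE /=; have := lew j; lia.
have Vf : V f by apply/forallP => s; rewrite !vecf w0 wr.
have := congr1 (fun M : 'rV[int]_#|F| => M 0 (enum_rank f)) AB.
rewrite [RHS]mxE mxE big_split_ord big_ord1 /= => AB0.
rewrite -[RHS]AB0; congr (A 0 _ * _ + _); first exact/val_inj.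
- by rewrite !mxE enum_rankK Vf vecf -w0; congr w; apply/val_inj.
- by apply: eq_bigr => s _; rewrite !mxE enum_rankK Vf vecf wr.
Qed.

(** * Counting sub-boxes close to small rational points *)

Lemma PoszX (b n : nat) : (b ^ n)%N%:Z = b%:Z ^+ n.
Proof. by rewrite -[LHS]natz natrX natz. Qed.

(** With [h s = p ^ (m' s - m s)], an element [e] stands for the sub-box of centre
    [a s + p ^ m s * e s]; the same type also serves for tuples of residues. *)
Definition subbox (N : nat) (h : 'I_N -> nat) : finType := {dffun forall s : 'I_N, 'I_(h s)}.

Lemma leq_card_subbox (N : nat) (h g : 'I_N -> nat) (P : {set subbox h})
    (phi : 'I_N -> nat -> nat) :
  (forall s x, x < h s -> phi s x < g s)%N ->
  (forall e e' : subbox h, e \in P -> e' \in P ->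
     (forall s, phi s (e s) = phi s (e' s)) -> forall s, e s = e' s :> nat) ->
  (#|P| <= \prod_s g s)%N.
Proof.
move=> phi_lt phi_inj.
pose f (e : subbox h) : subbox g := [ffun s => Ordinal (phi_lt s (e s) (ltn_ord (e s)))].
have f_inj : {in P &, injective f}.
  move=> e e' Pe Pe' /ffunP ff'; apply/ffunP => s; apply/val_inj/phi_inj => // u.
  by have := congr1 val (ff' u); rewrite !ffunE.
rewrite -(card_in_imset f_inj); apply: leq_trans (max_card _) _.
rewrite card_dep_ffun foldrE big_map big_enum /=.
by rewrite (eq_bigr g) // => s _; rewrite card_ord.
Qed.

Lemma card_subbox (N : nat) (h : 'I_N -> nat) : #|subbox h| = (\prod_s h s)%N.
Proof.
rewrite card_dep_ffun foldrE big_map big_enum /=.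
by apply: eq_bigr => s _; rewrite card_ord.
Qed.

Lemma exists_min_valuation (p N : nat) (G : 'I_N -> int) : prime p ->
  (exists s, G s != 0) ->
  exists l s0, (forall s, (p%:Z ^+ l %| G s)%Z) /\ ~~ (p%:Z ^+ l.+1 %| G s0)%Z.
Proof.
move=> p_pr [s1 Gs1].
have dvdG s l : G s != 0 -> (p%:Z ^+ l %| G s)%Z = (l <= logn p `|G s|)%N.
  by move=> Gs; rewrite dvdzE abszX pfactor_dvdn // absz_gt0.
pose v s := logn p `|G s|.
case: (@arg_minnP _ s1 (fun s => G s != 0) v Gs1) => s0 Gs0 min; exists (v s0), s0; split=> [s|].
  by case: (eqVneq (G s) 0) => [->|Gs]; rewrite ?dvdz0 // dvdG // min.
by rewrite dvdG // ltnn.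
Qed.

(* Only denominators [q] prime to [p] matter: a common power of [p] can be divided
   out of [(q, r)], see [BadZp_of_not_near]. *)
Definition near_small_point (p N H : nat) (m : 'I_N -> nat) (x : 'I_N -> nat) : Prop :=
  exists (q : int) (r : 'I_N -> int),
    [/\ (`|q| <= H)%N, (forall s, `|r s| <= H)%N, ~~ (p%:Z %| q)%Z &
        forall s, (p%:Z ^+ m s %| q * (x s)%:Z - r s)%Z].

Lemma card_near_small_point (p N H k : nat) (a m m' : 'I_N -> nat)
    (P : {set subbox (fun s => p ^ (m' s - m s))%N}) :
  prime p ->
  ((1 + N)`! * H ^ (1 + N) < p ^ (\sum_s m s))%N ->
  (forall s, m s + k <= m' s)%N ->
  (forall e, e \in P -> near_small_point p H m' (fun s => a s + p ^ m s * e s)%N) ->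
  (#|P| * p ^ k <= \prod_s p ^ (m' s - m s))%N.
Proof.
move=> p_pr lt_H lemm' nearP.
(* A dangerous sub-box [e] satisfies one nontrivial congruence
   [C + \sum_s G s * e s = 0] modulo [p^(l + k)], where [p^l] is the exact
   common power of [p] in the [G s]; it determines [e s0] modulo [p^k]. *)
have [A A_neq0 hypA] := small_points_hyperplane a lt_H.
pose G s := A 0 (rshift 1 s) * p%:Z ^+ m s.
pose C := A 0 0 + \sum_s A 0 (rshift 1 s) * (a s)%:Z.
have p_neq0 : p%:Z != 0 by rewrite -lt0n prime_gt0.
have near_dvd l e : (forall s, (p%:Z ^+ l %| G s)%Z) -> e \in P ->
    (p%:Z ^+ (l + k) %| C + \sum_s G s * (e s)%:Z)%Z /\ exists s, G s != 0.
  move=> dvdG /nearP[q [r [leq ler pNq dvdr]]].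
  have hyp0 : A 0 0 * q + \sum_s A 0 (rshift 1 s) * r s = 0.
    apply: hypA => // s; have := dvdr s.
    have le_m : (m s <= m' s)%N by apply: leq_trans (lemm' s); apply: leq_addr.
    move=> /(dvdz_trans (dvdz_exp2l _ le_m)).
    rewrite PoszD PoszM mulrDr addrAC rpredDr //.
    by rewrite mulrCA PoszX dvdz_mulr.
  have q_neq0 : q != 0 by apply: contraNneq pNq => ->; rewrite dvdz0.
  split; last first.
    apply/existsP; apply: contraNT A_neq0 => /existsPn A0.
    have {}A0 s : A 0 (rshift 1 s) = 0.
      have := A0 s; rewrite negbK mulf_eq0 expf_eq0 (negbTE p_neq0) andbF orbF.
      by move/eqP.
    apply/eqP/rowP => j; rewrite mxE; case: (split_ordP j) => s -> //.
    move: hyp0; rewrite big1 ?addr0 => [|u _]; last by rewrite A0 mul0r.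
    move/eqP; rewrite mulf_eq0 (negbTE q_neq0) orbF => /eqP <-.
    by congr (A _ _); apply/val_inj; rewrite ord1.
  have cop : coprimez (p%:Z ^+ (l + k)) q.
    by rewrite coprimezXl // coprimezE prime_coprime // -dvdzE.
  (* The equation of the hyperplane turns [q] times the left side into a combination of the
     [q * x s - r s], whose term of index [s] is a multiple of [G s * p ^ k], hence of
     [p ^ (l + k)]. *)
  rewrite -(Gauss_dvdzr _ cop).
  have -> : q * (C + \sum_s G s * (e s)%:Z) =
      \sum_s A 0 (rshift 1 s) * (q * (a s + p ^ m s * e s)%N%:Z - r s).
    move/eqP: hyp0; rewrite addr_eq0 => /eqP hyp0.
    rewrite !mulrDr [q * A 0 0]mulrC hyp0 !mulr_sumr -sumrN -!big_split /=.
    by apply: eq_bigr => s _; rewrite PoszD PoszM PoszX /G; ring.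
  apply: rpred_sum => s _.
  have /dvdzP[t ->] := dvdz_trans (dvdz_exp2l p%:Z (lemm' s)) (dvdr s).
  rewrite mulrCA !exprD [A 0 _ * _]mulrA dvdz_mull // dvdz_mul //; exact: dvdG.
have [/existsP exG|/existsPn G0] := boolP [exists s, G s != 0]; last first.
  have -> : P = finset.set0; last by rewrite cards0 mul0n.
  apply/setP => e; rewrite finset.in_set0; apply/negP => /(near_dvd 0%N) [] => [s|_ [s]].
    by rewrite dvd1z.
  by rewrite (negbTE (G0 s)).
have [l [s0 [dvdG ndvdG]]] := exists_min_valuation p_pr exG.
have le_k s : (k <= m' s - m s)%N by have := lemm' s; lia.
pose g s := (p ^ (m' s - m s - (if s == s0 then k else 0)))%N.
apply: (@leq_trans ((\prod_s g s) * p ^ k)%N); last first.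
  rewrite leq_eqVlt (bigD1 s0) //= [in X in _ == X](bigD1 s0) //= /g eqxx.
  rewrite mulnAC -expnD subnK // (eq_bigr (fun s => p ^ (m' s - m s))%N) ?eqxx // => s.
  by move/negbTE ->; rewrite subn0.
rewrite leq_mul2r; apply/orP; right.
apply: (leq_card_subbox (phi := fun s x => if s == s0 then x %/ p ^ k else x)%N).
  move=> s x; rewrite /g; case: eqP => _; last by rewrite subn0.
  by move=> ltx; rewrite ltn_divLR ?expn_gt0 ?prime_gt0 // -expnD subnK.
move=> e e' Pe Pe' eq_phi.
have eq_s s : s != s0 -> e s = e' s :> nat by move=> /negbTE ss0; have := eq_phi s; rewrite ss0.
suff eq_s0 : e s0 = e' s0 :> nat by move=> s; case: (eqVneq s s0) => [->|/eq_s].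
(* Subtracting the two congruences leaves only [G s0 * (e s0 - e' s0)]; as [G s0] is [p ^ l] times a
   number prime to [p], the entries agree modulo [p ^ k]. *)
have [d1 _] := near_dvd l e dvdG Pe; have [d2 _] := near_dvd l e' dvdG Pe'.
have := rpredB d1 d2.
rewrite opprD addrACA subrr add0r -sumrB (bigD1 s0) //= big1 ?addr0 => [|s /eq_s ->];
  last by rewrite subrr.
have /dvdzP[h Gh] := dvdG s0; rewrite Gh.
have pNh : ~~ (p%:Z %| h)%Z.
  apply: contra ndvdG => ph; rewrite Gh exprS; exact: dvdz_mul.
rewrite -mulrBr mulrC mulrA exprD [(p%:Z ^+ l) * _]mulrC dvdz_mul2r ?expf_neq0 //.
rewrite mulrC Gauss_dvdzr; last first.
  by rewrite coprimezXl // coprimezE prime_coprime // -dvdzE.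
move: (eq_phi s0); rewrite eqxx => eq_div dvd_sub.
have eq_mod : e s0 = e' s0 %[mod p ^ k].
  by move: dvd_sub; rewrite -PoszX -eqz_mod_dvd !modz_nat => /eqP[->].
by rewrite (divn_eq (e s0) (p ^ k)) (divn_eq (e' s0) (p ^ k)) eq_div eq_mod.
Qed.

(** * Greedy choice of nested boxes avoiding the balls *)

Lemma eq_of_eqn_modX (p l l' u v : nat) : (0 < p)%N -> (l <= l')%N ->
  (u < p ^ (l' - l))%N -> (v < p ^ (l' - l))%N ->
  p ^ l * u = p ^ l * v %[mod p ^ l'] -> u = v.
Proof.
move=> p_gt0 le_l ltu ltv; rewrite -(subnKC le_l) expnD -!muln_modr => /eqP.
by rewrite eqn_pmul2l ?expn_gt0 ?p_gt0 // !modn_small // => /eqP.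
Qed.

Section Greedy.
Variables (R : realType) (p N k : nat) (m : nat -> 'I_N -> nat) (H : nat -> nat).
Variables (b : nat -> 'I_N -> nat) (d : nat -> nat).
Hypotheses (p_pr : prime p) (k_gt0 : (0 < k)%N).
Hypothesis m_step : forall n s, (m n s + k <= m n.+1 s)%N.
Hypothesis m_ge : forall n s, (k * n <= m n s)%N.
Hypothesis H_small : forall n, ((1 + N)`! * H n ^ (1 + N) < p ^ (\sum_s m n s))%N.

Let p_gt0 : (0 < p)%N := prime_gt0 p_pr.

(** Volumes are counted in cells of level [d j], at which the [j]-th ball is a union of cells; these
    are the cells common to the ball and to the box of level [n] around [a]. *)
Let hits j n (a : 'I_N -> nat) : {set subbox (fun s => p ^ m (d j) s)%N} :=
  [set z : subbox (fun s => p ^ m (d j) s)%N |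
    [forall s, ((z s : nat) == a s %[mod p ^ m n s]) &&
               ((z s : nat) == b j s %[mod p ^ (k * d j)])]]%SET.

Let child n (a : 'I_N -> nat) (e : subbox (fun s => p ^ (m n.+1 s - m n s))%N) : 'I_N -> nat :=
  fun s => (a s + p ^ m n s * e s)%N.

Let m_mono n s : (m n s <= m n.+1 s)%N.
Proof. by apply: leq_trans (m_step n s); apply: leq_addr. Qed.

(** Sub-boxes of one box are disjoint, so each [z] is counted at most once on the left. *)
Let sum_hits j n a : (\sum_e #|hits j n.+1 (child (n := n) a e)| <= #|hits j n a|)%N.
Proof.
under eq_bigr do rewrite -sum1_card big_mkcond.
rewrite exchange_big -[leqRHS]sum1_card [leqRHS]big_mkcond /=; apply: leq_sum => z _.
have [e0 e0P|noe] := pickP (fun e => z \in hits j n.+1 (child (n := n) a e)); last first.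
  by rewrite big1 // => e _; rewrite noe.
have -> : z \in hits j n a.
  move: e0P; rewrite !finset.inE => /forallP hz; apply/forallP => s.
  have /andP[/eqP za ->] := hz s; rewrite andbT.
  rewrite -(modn_dvdm (z s) (dvdn_exp2l p (m_mono n s))) za.
  rewrite (modn_dvdm _ (dvdn_exp2l p (m_mono n s))) /child.
  by rewrite addnC mulnC modnMDl.
rewrite (bigD1 e0) //= e0P big1 ?addn0 // => e ne0; case: ifP => // eP; case/eqP: ne0.
apply/ffunP => s; apply/val_inj.
move: e0P eP; rewrite !finset.inE => /forallP/(_ s)/andP[/eqP z0 _] /forallP/(_ s)/andP[/eqP z1 _].
move/eqP: (etrans (esym z1) z0); rewrite eqn_modDl => /eqP.
exact: eq_of_eqn_modX.
Qed.

Let card_hits j n a : (#|hits j n a| * p ^ (k * d j * N) <= p ^ (\sum_s m (d j) s))%N.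
Proof.
have cardle : (#|hits j n a| <= \prod_s p ^ (m (d j) s - k * d j))%N.
  apply: (leq_card_subbox (phi := fun s x => (x %/ p ^ (k * d j))%N)).
    by move=> s x ltx; rewrite ltn_divLR ?expn_gt0 ?p_gt0 // -expnD subnK.
  move=> e e'; rewrite !finset.inE => /forallP he /forallP he' eq_div s.
  have /andP[_ /eqP eb] := he s; have /andP[_ /eqP e'b] := he' s.
  by rewrite (divn_eq (e s) (p ^ (k * d j))) (divn_eq (e' s) (p ^ (k * d j))) eq_div eb e'b.
apply: leq_trans (leq_mul cardle (leqnn _)) _.
rewrite -[X in (k * d j * X)%N]card_ord expnM -prod_nat_const -big_split /=.
under eq_bigr do rewrite -expnD subnK //.
by rewrite expn_sum.
Qed.

Let hits_gt0 j (a : 'I_N -> nat) : (forall s, a s = b j s %[mod p ^ (k * d j)]) ->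
  (0 < #|hits j (d j) a|)%N.
Proof.
move=> ab; apply/card_gt0P.
have lt_mod s : (a s %% p ^ m (d j) s < p ^ m (d j) s)%N by rewrite ltn_mod expn_gt0 p_gt0.
pose z : subbox (fun s => p ^ m (d j) s)%N := [ffun s => Ordinal (lt_mod s)].
exists z; rewrite finset.inE; apply/forallP => s; rewrite ffunE /= modn_mod eqxx /=.
by rewrite (modn_dvdm _ (dvdn_exp2l p (m_ge (d j) s))) ab.
Qed.

Let vol n : R := (p ^ (\sum_s m n s))%N%:R.
Let vol_gt0 n : 0 < vol n. Proof. by rewrite ltr0n expn_gt0 p_gt0. Qed.

(* The share of the box occupied by the [j]-th ball, doubled at each level
   that remains before the ball is resolved: at least half of the sub-boxes
   being admissible, some admissible sub-box does not increase [load]. *)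
Let weight j n a : R :=
  if (n <= d j)%N then 2 ^+ (d j - n) * #|hits j n a|%:R * vol n / vol (d j) else 0.

Let weight_ge0 j n a : 0 <= weight j n a.
Proof.
rewrite /weight; case: ifP => // _.
by rewrite !mulr_ge0 ?invr_ge0 ?exprn_ge0 ?ler0n // ltW.
Qed.

(** One factor 2 is lost between consecutive levels, and [vol n.+1 / vol n] is the number of
    sub-boxes: a sub-box has on average at most half the weight of the box. *)
Let sum_weight j n a :
  \sum_e weight j n.+1 (child (n := n) a e) <= (vol n.+1 / vol n) / 2 * weight j n a.
Proof.
rewrite /weight; case: ltnP => [lt_nd|_]; last first.
  by rewrite big1 // mulr_ge0 ?weight_ge0 // !mulr_ge0 ?invr_ge0 ?ltW.
rewrite (ltnW lt_nd) -mulr_suml -mulr_suml -mulr_sumr -natr_sum.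
rewrite -[(d j - n)%N]prednK ?subn_gt0 // -subnS exprS.
have -> : vol n.+1 / vol n / 2 * (2 * 2 ^+ (d j - n.+1) * #|hits j n a|%:R * vol n / vol (d j))
  = 2 ^+ (d j - n.+1) * #|hits j n a|%:R * vol n.+1 / vol (d j).
  by field; apply/andP; split; apply: lt0r_neq0 (vol_gt0 _).
rewrite ler_pM2r ?invr_gt0 // ler_pM2r // ler_wpM2l ?exprn_ge0 // ler_nat.
exact: sum_hits.
Qed.

Let load n a : \bar R := (\sum_(0 <= j <oo) (weight j n a)%:E)%E.

(** Admissible sub-boxes make up at least half of all. Were their loads all at least 1, they would
    sum to at least half the number of sub-boxes; but by [sum_weight] all loads together sum to at
    most that half times [load n a], which is less. *)
Let load_step n a : (load n a < 1)%E -> exists a' : 'I_N -> nat,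
  [/\ (load n.+1 a' < 1)%E, forall s, a' s = a s %[mod p ^ m n s] &
      ~ near_small_point p (H n) (m n.+1) a'].
Proof.
move=> load_lt1; apply: contrapT => noa'.
pose P := [set e | `[< near_small_point p (H n) (m n.+1) (child (n := n) a e) >]]%SET.
have cardP : (#|P| * p ^ k <= \prod_s p ^ (m n.+1 s - m n s))%N.
  apply: (card_near_small_point (a := a) p_pr (H_small n) (m_step n)) => e.
  by rewrite finset.inE => /asboolP.
have load_ge1 e : e \notin P -> (1 <= load n.+1 (child (n := n) a e))%E.
  rewrite finset.inE => /asboolP nP; rewrite leNgt; apply/negP => lt1; apply: noa'.
  by exists (child (n := n) a e); split=> // s; rewrite /child addnC mulnC modnMDl.
have volE : vol n.+1 / vol n = (\prod_s p ^ (m n.+1 s - m n s))%N%:R.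
  apply: (canLR (mulfK (lt0r_neq0 (vol_gt0 n)))); rewrite /vol -natrM; congr _%:R.
  rewrite -expn_sum -expnD -big_split /=; congr (_ ^ _)%N.
  by apply: eq_bigr => s _; rewrite subnK.
pose Q := (~: P)%SET; pose Vn := vol n.+1 / vol n.
have Vn_gt0 : 0 < Vn by rewrite divr_gt0.
have half : Vn / 2 <= #|Q|%:R.
  rewrite /Vn volE ler_pdivrMr // -natrM ler_nat; move: cardP.
  rewrite -card_subbox -(cardsC P) -/Q; move: #|P| #|Q| => x y.
  have : (2 <= p ^ k)%N by 
    rewrite (leq_trans (prime_gt1 p_pr)) // -{1}(expn1 p) leq_exp2l ?prime_gt1.
  by move: (p ^ k)%N => K; nia.
have : ((Vn / 2)%:E < (Vn / 2)%:E)%E.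
  apply: (@le_lt_trans _ _ (\sum_e load n.+1 (child (n := n) a e))%E).
    apply: (@le_trans _ _ (\sum_(e in Q) 1)%E).
      by rewrite sumEFin lee_fin sumr_const; exact: half.
    rewrite [leRHS](bigID (fun e => e \in Q)) /=.
    apply: (@le_trans _ _ (\sum_(e in Q) load n.+1 (child (n := n) a e))%E).
      by apply: lee_sum => e; rewrite finset.in_setC => /load_ge1.
    apply: leeDl; apply: sume_ge0 => e _; apply: nneseries_ge0 => j _ _.
    by rewrite lee_fin weight_ge0.
  rewrite /load -nneseries_sum; last by move=> *; rewrite lee_fin weight_ge0.
  apply: (@le_lt_trans _ _ (\sum_(0 <= j <oo) ((Vn / 2)%:E * (weight j n a)%:E))%E).
    apply: lee_nneseries => j _.
      by move=> *; rewrite sume_ge0 // => *; rewrite lee_fin weight_ge0.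
    by rewrite sumEFin -EFinM lee_fin sum_weight.
  rewrite nneseriesZl; last by move=> *; rewrite lee_fin weight_ge0.
  by rewrite -[ltRHS]mule1 lte_pmul2l // lte_fin divr_gt0.
by rewrite ltxx.
Qed.

(** The series bounds the load of the initial box, and iterating [load_step] keeps the load below 1
    at every level. *)
Lemma greedy_boxes :
  (\sum_(0 <= j <oo) ((2 ^+ d j * vol 0) / (p ^ (k * d j * N))%N%:R)%:E < 1)%E ->
  exists a : nat -> 'I_N -> nat,
    [/\ forall n s, a n.+1 s = a n s %[mod p ^ m n s],
        forall n, ~ near_small_point p (H n) (m n.+1) (a n.+1) &
        forall j, ~ forall s, a (d j) s = b j s %[mod p ^ (k * d j)]].
Proof.
move=> sum_lt1.
have load0 : (load 0 (fun=> 0%N) < 1)%E.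
  apply: le_lt_trans sum_lt1; apply: lee_nneseries => j _.
    by move=> *; rewrite lee_fin weight_ge0.
  rewrite lee_fin /weight subn0 /= ler_pdivrMr // mulrAC -[leRHS]mulrA.
  have vol_ge0 := ltW (vol_gt0 0); rewrite ler_wpM2l ?mulr_ge0 ?exprn_ge0 //.
  by rewrite ler_pdivlMl ?ltr0n ?expn_gt0 ?p_gt0 // mulrC -natrM ler_nat card_hits.
pose st n := {a | (load n a < 1)%E}.
pose nxt n (x : st n) : st n.+1 :=
  let y := cid (load_step (svalP x)) in exist _ (sval y) (let: And3 l _ _ := svalP y in l).
pose seq := nat_rect st (exist (fun a => (load 0 a < 1)%E) _ load0) nxt.
exists (fun n => sval (seq n)); split=> [n s|n|j ab].
- by have [_ + _] := svalP (cid (load_step (svalP (seq n)))); apply.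
- by have [_ _] := svalP (cid (load_step (svalP (seq n)))).
have := svalP (seq (d j)); apply/negP; rewrite -leNgt.
(* At level [d j] the weight is the number of hits, at least 1 if the box lies in the ball. *)
apply: (@le_trans _ _ (weight j (d j) (sval (seq (d j))))%:E).
  rewrite lee_fin /weight leqnn subnn expr0 mul1r mulfK ?gt_eqF // ler1n.
  exact: hits_gt0.
rewrite /load.
apply: le_trans (nneseries_lim_ge j.+1 _); last by move=> *; rewrite lee_fin weight_ge0.
rewrite big_nat_recr //= leeDr // sume_ge0 // => *; rewrite lee_fin weight_ge0 //.
Qed.

End Greedy.

(** * p-adic integers and their absolute value *)

Lemma zp_res_mod (p : nat) (x : Zpadic p) n n' : (n <= n')%N ->
  (zp_res x n' %% p ^ n)%N = zp_res x n.
Proof.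
move/subnKC <-; elim: (n' - n)%N => [|l IHl].
  by rewrite addn0 modn_small //; case: (proj2_sig x n).
rewrite addnS -IHl -(modn_dvdm _ (dvdn_exp2l p (leq_addr l n))).
by case: (proj2_sig x (n + l)%N) => _ ->.
Qed.

Lemma zp_res_eqz_mod (p : nat) (x : Zpadic p) n n' : (n <= n')%N ->
  (p%:Z ^+ n %| (zp_res x n')%:Z - (zp_res x n)%:Z)%Z.
Proof.
move=> le_n; rewrite -PoszX -eqz_mod_dvd !modz_nat -(zp_res_mod x le_n).
by rewrite modn_mod.
Qed.

Lemma Zpadic_limit (p : nat) (a mu : nat -> nat) : prime p ->
  (forall n, n <= mu n)%N -> (forall n, mu n <= mu n.+1)%N ->
  (forall n, a n.+1 = a n %[mod p ^ mu n]) ->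
  exists x : Zpadic p, forall n, zp_res x (mu n) = (a n %% p ^ mu n)%N.
Proof.
move=> p_pr mu_ge mu_mono a_step.
have a_mod n n' : (n <= n')%N -> a n' = a n %[mod p ^ mu n].
  move/subnKC <-; elim: (n' - n)%N => [|l IHl]; first by rewrite addn0.
  have le_mu : (mu n <= mu (n + l))%N.
    by elim: l {IHl} => [|l IHl]; rewrite ?addn0 // addnS (leq_trans IHl).
  rewrite addnS -IHl -(modn_dvdm _ (dvdn_exp2l p le_mu)) a_step.
  by rewrite (modn_dvdm _ (dvdn_exp2l p le_mu)).
(* Since [n <= mu n], the residue of [a n] modulo [p ^ n] is already final. *)
have xP n : (a n %% p ^ n < p ^ n)%N /\ ((a n.+1 %% p ^ n.+1) %% p ^ n)%N = (a n %% p ^ n)%N.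
  split; first by rewrite ltn_mod expn_gt0 prime_gt0.
  rewrite (modn_dvdm _ (dvdn_exp2l p (leqnSn n))) -(modn_dvdm _ (dvdn_exp2l p (mu_ge n))).
  by rewrite a_step (modn_dvdm _ (dvdn_exp2l p (mu_ge n))).
by exists (exist _ (fun n => a n %% p ^ n)%N xP) => n; apply: a_mod.
Qed.

Lemma pabs_le (R : realType) (p : nat) (u : nat -> int) n :
  (p%:Z ^+ n %| u n)%Z -> pabs R p u <= p%:R ^- n.
Proof.
move=> dvdu; apply: ge_inf; last by exists n.
by exists 0 => _ [l _ <-]; rewrite invr_ge0 exprn_ge0.
Qed.

Lemma pabs_ge0 (R : realType) (p : nat) (u : nat -> int) : 0 <= pabs R p u.
Proof.
apply: lb_le_inf; first by exists 1, 0%N => //=; rewrite expr0 ?invr1 // dvd1z.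
by move=> _ [l _ <-]; rewrite invr_ge0 exprn_ge0.
Qed.

(** The infimum runs over powers of [p], so a value strictly below [p ^ (1 - n)] yields some
    [l >= n] with [p ^ l] dividing [u l]; compatibility brings this down to level [n]. *)
Lemma dvdz_of_pabs_lt (R : realType) (p : nat) (u : nat -> int) n : prime p ->
  (forall l l', (l <= l')%N -> (p%:Z ^+ l %| u l' - u l)%Z) ->
  pabs R p u < p%:R * p%:R ^- n -> (p%:Z ^+ n %| u n)%Z.
Proof.
move=> p_pr u_mod /inf_lt[|_ [l /= dvdu <-]].
  by exists 1, 0%N => //=; rewrite expr0 ?invr1 // dvd1z.
have p_gt1 : 1 < p%:R :> R by rewrite ltr1n prime_gt1.
have p_gt0 : 0 < p%:R :> R by rewrite ltr0n prime_gt0.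
rewrite ltr_pdivlMr ?exprn_gt0 // mulrC ltr_pdivrMr ?exprn_gt0 // -exprS.
rewrite ltr_eXn2l // ltnS => le_nl.
rewrite -(subKr (u l) (u n)) rpredB ?u_mod //.
exact: dvdz_trans (dvdz_exp2l _ le_nl) dvdu.
Qed.

(** * Points of [BadZp] as limits of boxes *)

(* The box of level [n] has sides [p ^- side n s], where [side n s] is
   [(1 + i s) * k * (n + 1)] rounded up. *)
Definition side (R : realType) (N : nat) (i : 'I_N -> R) (k n : nat) (s : 'I_N) : nat :=
  (k * n.+1 + Num.truncn (i s * (k * n.+1)%:R)).+1.

(** A pair [(q, r)] violating the inequality, once divided by the exact power [p ^ j] of [p] in [q],
    is a small point near the box of level [n + 1], where [p ^ (k * n)] is the least power of
    [p ^ k] reaching the reduced height. *)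
Lemma BadZp_of_not_near (R : realType) (p N k : nat) (i : 'I_N -> R) (x : 'I_N -> Zpadic p) :
  prime p -> (0 < k)%N -> (forall s, 0 <= i s) ->
  (forall n, ~ near_small_point p (p ^ (k * n)) (side i k n.+1)
                 (fun s => zp_res (x s) (side i k n.+1 s))) ->
  BadZp R p N i x.
Proof.
move=> p_pr k_gt0 i_ge0 not_near.
have p_gt0 : 0 < p%:R :> R by rewrite ltr0n prime_gt0.
have p_ge1 : 1 <= p%:R :> R by rewrite ler1n prime_gt0.
(* Two factors [p ^ k] pay for the exponent [k * n.+2] in [side i k n.+1], the third for rounding
   the height up to a power of [p ^ k]. *)
exists ((p%:R ^+ (3 * k))^-1); first by rewrite invr_gt0 exprn_gt0.
move=> r q q_neq0; rewrite leNgt; apply/negP => lt_max.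
set Hz := Num.max _ _ in lt_max.
have le_q : `|q| <= Hz by rewrite /Hz le_max lexx orbT.
have le_r s : `|r s| <= Hz by rewrite /Hz le_max le_bigmax.
pose h := absz Hz.
have Hz_ge0 : 0 <= Hz by apply: le_trans le_q.
have hE : Hz = h%:Z by rewrite /h gez0_abs.
have {}le_q : (absz q <= h)%N by rewrite -lez_nat -hE abszE.
have {}le_r s : (absz (r s) <= h)%N by rewrite -lez_nat -hE abszE.
have q_gt0 : (0 < absz q)%N by rewrite absz_gt0.
have h_gt0 : (0 < h)%N by apply: leq_trans le_q.
move: lt_max; rewrite hE -pmulrn => lt_max.
pose c : R := (p%:R ^+ (3 * k))^-1 / h%:R.
have c_gt0 : 0 < c by rewrite divr_gt0 ?ltr0n // invr_gt0 exprn_gt0.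
have y_gt0 s : 0 < 1 + i s by rewrite ltr_pwDl.
have lt_pabs s : pabs_lin R p q (x s) (r s) < c `^ (1 + i s).
  have : pabs_lin R p q (x s) (r s) `^ (1 + i s)^-1 < c.
    by apply: le_lt_trans lt_max; apply: le_bigmax.
  move/(gt0_ltr_powR (y_gt0 s)); rewrite !nnegrE powR_ge0 (ltW c_gt0) => /(_ isT isT).
  by rewrite -powRrM mulVf ?gt_eqF // powRr1 // pabs_ge0.
pose j := logn p (absz q).
have pj_dvd : (p ^ j %| absz q)%N by rewrite pfactor_dvdn.
pose h' := (h %/ p ^ j)%N.
have pj_gt0 : (0 < p ^ j)%N by rewrite expn_gt0 prime_gt0.
have h'_gt0 : (0 < h')%N by rewrite divn_gt0 // (leq_trans _ le_q) // dvdn_leq.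
have pk_gt1 : (1 < p ^ k)%N by rewrite -(exp1n k) ltn_exp2r ?prime_gt1.
pose n := up_log (p ^ k) h'.
have le_h' : (h' <= p ^ (k * n))%N by rewrite expnM up_logP.
have le_pn : (p ^ (k * n) * p ^ j <= p ^ k * h)%N.
  apply: (@leq_trans (p ^ k * h' * p ^ j)%N); last first.
    by rewrite -mulnA leq_mul2l leq_trunc_div orbT.
  rewrite leq_mul2r expnM; apply/orP; right.
  have [h'1|h'_gt1] := leqP h' 1.
    by rewrite /n (_ : up_log _ _ = 0%N) ?expn0 ?muln_gt0 ?h'_gt0 ?(ltnW pk_gt1) //;
       apply/eqP; rewrite up_log_eq0 h'1 orbT.
  have := up_log_gtn pk_gt1 h'_gt1; rewrite -/n => /ltnW le1.
  by rewrite -[X in (_ ^ X)%N]prednK ?up_log_gt0 ?pk_gt1 // expnS leq_mul2l le1 orbT.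
have dvd_lin s : (p%:Z ^+ (side i k n.+1 s + j) %|
    q * (zp_res (x s) (side i k n.+1 s + j))%:Z - r s)%Z.
  (* The spare factor [p] in [dvdz_of_pabs_lt] absorbs the rounding up in [side]. *)
  apply: (@dvdz_of_pabs_lt R p (fun l => q * (zp_res (x s) l)%:Z - r s)) => // [l l' le_l|].
    by rewrite opprB addrA subrK -mulrBr dvdz_mull // zp_res_eqz_mod.
  apply: lt_le_trans (lt_pabs s) _.
  rewrite ler_pdivlMr ?exprn_gt0 //.
  pose X : R := p%:R ^+ (k * n.+2).
  have X_gt0 : 0 < X by rewrite exprn_gt0.
  have X_ge0 := ltW X_gt0; have p_ge0 := ltW p_gt0; have c_ge0 := ltW c_gt0.
  have le_side : p%:R ^+ (side i k n.+1 s) <= p%:R * X `^ (1 + i s) :> R.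
    rewrite /side exprS ler_pM2l // exprD -/X powRD; last by rewrite gt_eqF ?implybT.
    rewrite powRr1 // ler_pM2l // /X -!powR_mulrn // -powRrM.
    by rewrite ler_powR // mulrC truncn_le mulr_ge0.
  have le_pj : p%:R ^+ j <= (p%:R ^+ j) `^ (1 + i s) :> R.
    rewrite -[leLHS]powRr1 ?exprn_ge0 // ler_powR ?exprn_ege1 //.
    by rewrite lerDl.
  rewrite exprD; apply: le_trans
    (_ : c `^ (1 + i s) * ((p%:R * X `^ (1 + i s)) * (p%:R ^+ j) `^ (1 + i s)) <= _).
    by rewrite ler_wpM2l ?powR_ge0 // ler_pM ?exprn_ge0.
  have le1 : c * X * p%:R ^+ j <= 1.
    rewrite /c /X -mulrA mulrAC -mulrA ler_pdivrMl ?mulr1 ?exprn_gt0 //.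
    rewrite ler_pdivrMr ?ltr0n // -!natrX -!natrM ler_nat.
    have -> : (k * n.+2 = k * n + 2 * k)%N by rewrite -addn2 mulnDr [(k * 2)%N]mulnC.
    have -> : (3 * k = 2 * k + k)%N by rewrite mulSn addnC.
    rewrite [(p ^ (k * n + _))%N]expnD [(p ^ (2 * k + k))%N]expnD -!mulnA mulnCA.
    rewrite leq_mul2l; apply/orP; right.
    exact: le_pn.
  have -> : c `^ (1 + i s) * (p%:R * X `^ (1 + i s) * (p%:R ^+ j) `^ (1 + i s)) =
      p%:R * ((c * X * p%:R ^+ j) `^ (1 + i s)).
    by rewrite !powRM ?mulr_ge0 ?exprn_ge0 //; ring.
  have powR1s : 1 `^ (1 + i s) = 1 by rewrite powR1.
  rewrite -[leRHS]mulr1 ler_pM2l // -[leRHS]powR1s.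
  by rewrite ge0_ler_powR ?nnegrE ?mulr_ge0 ?exprn_ge0 // ltW.
apply: (not_near n); exists (q %/ p%:Z ^+ j)%Z, (fun s => (r s %/ p%:Z ^+ j)%Z).
have pjz_neq0 : p%:Z ^+ j != 0 by rewrite -PoszX -lt0n.
have dvd_q : (p%:Z ^+ j %| q)%Z by rewrite dvdzE abszX.
have dvd_r s : (p%:Z ^+ j %| r s)%Z.
  have := dvdz_trans (dvdz_exp2l p%:Z (leq_addl (side i k n.+1 s) j)) (dvd_lin s).
  move=> dvd1; rewrite -(subKr (q * (zp_res (x s) (side i k n.+1 s + j))%:Z) (r s)).
  by rewrite rpredB // dvdz_mulr.
have le_div (z : int) : (absz z <= h)%N -> (p%:Z ^+ j %| z)%Z ->
    (absz (z %/ p%:Z ^+ j)%Z <= p ^ (k * n))%N.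
  move=> le_z /divzK {}dvd_z; apply: leq_trans le_h'.
  by rewrite /h' leq_divRL // -[X in (X <= _)%N]/(absz _ * absz (p ^ j)%N%:Z)%N PoszX -abszM dvd_z.
split=> [|s||s]; rewrite ?le_div //.
  apply/negP => /dvdzP[t tE]; have := divzK dvd_q; rewrite tE => qE.
  have : (p ^ j.+1 %| absz q)%N by rewrite -qE -mulrA -exprS abszM abszX dvdn_mull.
  by rewrite pfactor_dvdn // ltnn.
have := dvd_lin s; rewrite -{1}(divzK dvd_q) -{1}(divzK (dvd_r s)).
rewrite mulrAC -mulrBl exprD dvdz_mul2r //.
set q' := (q %/ _)%Z; set r' := (r s %/ _)%Z => dvd1.
have dvd2 := dvdz_mull q' (zp_res_eqz_mod (x s) (leq_addr j (side i k n.+1 s))).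
rewrite (_ : q' * _ - r' = (q' * (zp_res (x s) (side i k n.+1 s + j))%:Z - r') -
  q' * ((zp_res (x s) (side i k n.+1 s + j))%:Z - (zp_res (x s) (side i k n.+1 s))%:Z)).
  exact: rpredB.
ring.
Qed.

Lemma near_small_point_eqmod (p N H : nat) (m x y : 'I_N -> nat) :
  (forall s, x s = y s %[mod p ^ m s]) ->
  near_small_point p H m x -> near_small_point p H m y.
Proof.
move=> xy [q [r [leq ler pNq dvdr]]]; exists q, r; split=> // s.
have dvd_yx : (p%:Z ^+ m s %| (y s)%:Z - (x s)%:Z)%Z.
  by rewrite -PoszX -eqz_mod_dvd !modz_nat xy.
rewrite (_ : _ - r s = (q * (x s)%:Z - r s) + q * ((y s)%:Z - (x s)%:Z)).
  by rewrite rpredD ?dvdz_mull.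
by ring.
Qed.

(** * Distances, diameters and balls *)

Lemma zpN_dist_le (R : realType) (p N n : nat) (x y : 'I_N -> Zpadic p) :
  (forall s, zp_res (x s) n = zp_res (y s) n) -> zpN_dist R p N x y <= p%:R ^- n.
Proof.
move=> xy; apply: bigmax_le => [|s _]; first by rewrite invr_ge0 exprn_ge0.
by apply: pabs_le; rewrite xy subrr dvdz0.
Qed.

Lemma zp_res_of_dist_le (R : realType) (p N n : nat) (x y : 'I_N -> Zpadic p) : prime p ->
  zpN_dist R p N x y <= p%:R ^- n -> forall s, zp_res (x s) n = zp_res (y s) n.
Proof.
move=> p_pr le_dist s.
have le_s : pabs_sub R p (x s) (y s) <= p%:R ^- n.
  apply: le_trans le_dist; exact: (le_bigmax _ (fun s => pabs_sub R p (x s) (y s))).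
have p_gt0 : 0 < p%:R :> R by rewrite ltr0n prime_gt0.
have : (p%:Z ^+ n %| (zp_res (x s) n)%:Z - (zp_res (y s) n)%:Z)%Z.
  apply: (@dvdz_of_pabs_lt R p (fun n => (zp_res (x s) n)%:Z - (zp_res (y s) n)%:Z)) => //.
    move=> l l' le_l; rewrite (_ : _ - _ = ((zp_res (x s) l')%:Z - (zp_res (x s) l)%:Z) -
      ((zp_res (y s) l')%:Z - (zp_res (y s) l)%:Z)); first by rewrite rpredB ?zp_res_eqz_mod.
    by ring.
  apply: le_lt_trans le_s _; rewrite -{1}[p%:R ^- n]mul1r ltr_pM2r ?invr_gt0 ?exprn_gt0 //.
  by rewrite ltr1n prime_gt1.
rewrite -PoszX -eqz_mod_dvd !modz_nat => /eqP[].
by rewrite !zp_res_mod.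
Qed.

Lemma zpN_dist_ge0 (R : realType) (p N : nat) (x y : 'I_N -> Zpadic p) :
  0 <= zpN_dist R p N x y.
Proof. exact: bigmax_ge_id. Qed.

Lemma exprVn_powR_small (R : realType) (p : nat) (t e : R) : (1 < p)%N -> 0 < t -> 0 < e ->
  exists n, forall n', (n <= n')%N -> (p%:R ^- n') `^ t <= e.
Proof.
move=> p_gt1 t_gt0 e_gt0.
have p_gt0 : 0 < p%:R :> R by rewrite ltr0n ltnW.
pose y := e `^ t^-1; have y_gt0 : 0 < y by rewrite powR_gt0.
exists (Num.truncn y^-1).+1 => n' le_n.
have eE : e = y `^ t by rewrite /y -powRrM mulVf ?powRr1 ?gt_eqF // ltW.
rewrite eE ge0_ler_powR ?nnegrE ?(ltW t_gt0) ?(ltW y_gt0) ?invr_ge0 ?exprn_ge0 //.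
rewrite -[leRHS]invrK lef_pV2 ?posrE ?invr_gt0 ?exprn_gt0 //.
apply: le_trans (ltW (truncnS_gt _)) _; rewrite -natrX ler_nat.
by apply: leq_trans le_n _; apply/ltnW/ltn_expl.
Qed.

Section Diameter.
Variables (R : realType) (p N : nat).
Hypothesis p_pr : prime p.
Let dist : ('I_N -> Zpadic p) -> ('I_N -> Zpadic p) -> R := zpN_dist R p N.
Let p_gt0 : 0 < p%:R :> R. Proof. by rewrite ltr0n prime_gt0. Qed.

Lemma diam_ge0 (U : set ('I_N -> Zpadic p)) : U !=set0 -> (0 <= diam dist U)%E.
Proof.
move=> [x Ux]; apply: (@le_trans _ _ (dist x x)%:E).
  by rewrite lee_fin zpN_dist_ge0.
by apply: ereal_sup_ubound; exists (x, x).
Qed.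

Lemma hcost_ge0 s (U : set ('I_N -> Zpadic p)) : (0 <= hcost dist s U)%E.
Proof.
rewrite /hcost; case: ifP => // _; case: (diam _ _) => [r||] //.
by rewrite lee_fin powR_ge0.
Qed.

Lemma hcost_le s n (U : set ('I_N -> Zpadic p)) : 0 <= s ->
  (diam dist U <= (p%:R ^- n)%:E)%E -> (hcost dist s U <= ((p%:R ^- n) `^ s)%:E)%E.
Proof.
move=> s_ge0 le_diam; rewrite /hcost; case: ifP => [_|/asboolP/eqP/set0P U0].
  by rewrite lee_fin powR_ge0.
move: (diam_ge0 U0) le_diam; case: (diam _ _) => [r||] //; rewrite !lee_fin => r_ge0 le_r.
by rewrite ge0_ler_powR ?nnegrE ?invr_ge0 ?exprn_ge0.
Qed.

(** For a diameter [0 < r <= 1] choose [n] with [p^(-k(n+1)) < r <= p^(-kn)]; then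
    [p^(-knt) <= p^(kt) r^t <= p^(kt) r^s]. Empty sets and sets of diameter 0 get a ball so small
    that [e] pays for it. *)
Lemma set_in_ball k s t e (U : set ('I_N -> Zpadic p)) : (0 < k)%N -> s <= t -> 0 < t -> 0 < e ->
  (diam dist U <= 1%:E)%E ->
  exists bd : ('I_N -> nat) * nat,
    (forall x, U x -> forall l, zp_res (x l) (k * bd.2) = bd.1 l %[mod p ^ (k * bd.2)]) /\
    (((p%:R ^- (k * bd.2)) `^ t)%:E <= ((p%:R ^+ k) `^ t)%:E * hcost dist s U + e%:E)%E.
Proof.
move=> k_gt0 le_st t_gt0 e_gt0 diam_le1.
have t_ge0 := ltW t_gt0.
have [n0 n0P] := exprVn_powR_small (prime_gt1 p_pr) t_gt0 e_gt0.
have small : (((p%:R ^- (k * n0)) `^ t)%:E <= ((p%:R ^+ k) `^ t)%:E * hcost dist s U + e%:E)%E.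
  apply: (@le_trans _ _ e%:E).
    by rewrite lee_fin n0P // leq_pmull.
  by rewrite leeDr // mule_ge0 ?hcost_ge0 // lee_fin powR_ge0.
have [U0|/set0P[u Uu]] := eqVneq U set0.
  by exists (fun=> 0%N, n0); split=> // x; rewrite U0.
have in_ball n : (diam dist U <= (p%:R ^- n)%:E)%E ->
    forall x, U x -> forall l, zp_res (x l) n = zp_res (u l) n %[mod p ^ n].
  move=> le_diam x Ux l; congr (_ %% _)%N.
  apply: (@zp_res_of_dist_le R) => //; rewrite -lee_fin; apply: le_trans le_diam.
  by apply: ereal_sup_ubound; exists (x, u).
have U0 : U !=set0 by exists u.
move: small; rewrite /hcost asboolF; last by apply/eqP/set0P.
move: (diam_ge0 U0) diam_le1 in_ball; case: (diam dist U) => [r||] //.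
rewrite !lee_fin => r_ge0 r_le1 in_ball small.
have [r0|r_neq0] := eqVneq r 0.
  exists ((fun l => zp_res (u l) (k * n0)), n0); split=> //=; apply: in_ball.
  by rewrite lee_fin r0 invr_ge0 exprn_ge0.
have r_gt0 : 0 < r by rewrite lt0r r_neq0.
have exn : exists n, p%:R ^- (k * n) < r.
  have r2 : 0 < r / 2 by rewrite divr_gt0.
  have [n nP] := exprVn_powR_small (prime_gt1 p_pr) ltr01 r2.
  exists n; have := nP (k * n)%N (leq_pmull _ k_gt0); rewrite powRr1 ?invr_ge0 ?exprn_ge0 //.
  by move/le_lt_trans; apply; rewrite ltr_pdivrMr // ltr_pMr // ltr1n.
case: (ex_minnP exn) => -[|n] lt_r min_n.
  by move: lt_r; rewrite muln0 expr0 invr1 ltNge r_le1.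
have le_r : r <= p%:R ^- (k * n).
  by rewrite leNgt; apply/negP => /min_n; rewrite ltnn.
exists ((fun l => zp_res (u l) (k * n)), n); split=> /=; first exact: in_ball.
rewrite -EFinM -EFinD lee_fin; apply: (@le_trans _ _ ((p%:R ^+ k) `^ t * r `^ s)).
  2: by rewrite lerDl ltW.
apply: (@le_trans _ _ ((p%:R ^+ k) `^ t * r `^ t)); last first.
  by rewrite ler_wpM2l ?powR_ge0 // ger_powR ?r_gt0.
rewrite -powRM ?exprn_ge0 // ge0_ler_powR ?nnegrE ?mulr_ge0 ?invr_ge0 ?exprn_ge0 //.
move: lt_r; rewrite mulnS exprD invfM mulrC ltr_pdivrMr ?exprn_gt0 //.
by rewrite mulrC => /ltW.
Qed.

End Diameter.

(** * Growth of the sides, and points of [BadZp] outside given balls *)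

Section Side.
Variables (R : realType) (N : nat) (i : 'I_N -> R) (k : nat).
Hypothesis i_ge0 : forall s, 0 <= i s.

Lemma side_step n s : (side i k n s + k <= side i k n.+1 s)%N.
Proof.
rewrite /side addSn ltnS addnAC [(k * n.+2)%N]mulnS [(k + _)%N]addnC leq_add2l.
by apply: le_truncn; rewrite ler_wpM2l // ler_nat leq_addr.
Qed.

Lemma side_ge n s : (k * n <= side i k n s)%N.
Proof. by rewrite leqW // (leq_trans _ (leq_addr _ _)) // leq_mul2l leqnSn orbT. Qed.

(** The successor in [side] makes up for the truncation, and [\sum_s i s = 1] contributes one more
    [k * n.+1] to the [N] evident ones. *)
Lemma sum_side_ge n : \sum_s i s = 1 -> (k * n.+1 * N.+1 <= \sum_s side i k n s)%N.
Proof.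
move=> sum_i; rewrite /side; under eq_bigr do rewrite -addnS.
rewrite big_split /= sum_nat_const card_ord mulnS addnC mulnC leq_add2l.
rewrite -(ler_nat R) natr_sum -[leLHS]mul1r -[X in X * _ <= _]sum_i mulr_suml.
by apply: ler_sum => s _; apply/ltW/truncnS_gt.
Qed.

End Side.

Lemma BadZp_avoids_balls (R : realType) (p N : nat) (i : 'I_N -> R) (t : R) :
  prime p -> (forall s, 0 <= i s) -> \sum_s i s = 1 -> t < N%:R ->
  exists k V, [/\ (0 < k)%N, 0 < V & forall (b : nat -> 'I_N -> nat) (d : nat -> nat),
    (\sum_(0 <= j <oo) (V * (p%:R ^- (k * d j)) `^ t)%:E < 1)%E ->
    exists2 x, BadZp R p N i x &
      forall j, ~ forall l, zp_res (x l) (k * d j) = b j l %[mod p ^ (k * d j)]].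
Proof.
move=> p_pr i_ge0 sum_i lt_tN.
have p_gt0 : 0 < p%:R :> R by rewrite ltr0n prime_gt0.
have p_gt1 := prime_gt1 p_pr.
have Nt_gt0 : 0 < N%:R - t by rewrite subr_gt0.
have half_gt0 : 0 < 2^-1 :> R by rewrite invr_gt0.
have [n0 n0P] := exprVn_powR_small p_gt1 Nt_gt0 half_gt0.
(* The factorial gives [p ^ k > (1 + N)!], as the simplex lemma needs at height [p ^ (k * n)]; [n0]
   gives [2 <= p ^ (k (N - t))]. *)
pose k := ((1 + N)`! + n0)%N.
have k_gt0 : (0 < k)%N by rewrite addn_gt0 fact_gt0.
have fact_lt : ((1 + N)`! < p ^ k)%N.
  by apply: leq_ltn_trans (ltn_expl _ p_gt1); rewrite leq_addr.
have le_half : (p%:R ^- k) `^ (N%:R - t) <= 2^-1 :> R by rewrite n0P // leq_addl.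
pose V : R := (p ^ (\sum_s side i k 0 s))%N%:R.
exists k, V; split=> // [|b d sum_lt1]; first by rewrite ltr0n expn_gt0 prime_gt0.
have small n : ((1 + N)`! * (p ^ (k * n)) ^ (1 + N) < p ^ (\sum_s side i k n s))%N.
  apply: (@leq_trans (p ^ (k * n.+1 * N.+1))%N); last first.
    by rewrite leq_exp2l // sum_side_ge.
  rewrite -expnM [(k * n.+1)%N]mulnS mulnDl expnD -add1n ltn_mul2r expn_gt0 prime_gt0 //=.
  by apply: leq_trans fact_lt _; rewrite leq_exp2l // leq_pmulr.
have [|a [a_step a_near a_ball]] := @greedy_boxes R p N k (side i k)
    (fun n => p ^ (k * n))%N b d p_pr k_gt0 (side_step k i_ge0) (side_ge i k) small.
  apply: le_lt_trans sum_lt1; apply: lee_nneseries => [j _ _|j _].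
    by rewrite lee_fin divr_ge0 ?mulr_ge0 ?exprn_ge0.
  rewrite lee_fin -/V mulrAC [leRHS]mulrC ler_wpM2r // ?ler0n //.
  (* The comparison is the [d j]-th power of [2 w^N <= w^t], which is [le_half]. *)
  pose w : R := p%:R ^- k; have w_gt0 : 0 < w by rewrite invr_gt0 exprn_gt0.
  have -> : p%:R ^- (k * d j) = w ^+ d j :> R by rewrite exprM exprVn.
  have -> : ((p ^ (k * d j * N))%N%:R)^-1 = (w ^+ N) ^+ d j :> R.
    by rewrite natrX mulnAC !exprM /w !exprVn.
  have -> : (w ^+ d j) `^ t = (w `^ t) ^+ d j.
    by rewrite -(powR_mulrn _ (ltW w_gt0)) -powRrM mulrC powRrM powR_mulrn ?powR_ge0.
  rewrite -exprMn lerXn2r ?nnegrE ?powR_ge0 ?mulr_ge0 ?exprn_ge0 ?(ltW w_gt0) //.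
  rewrite -ler_pdivlMl // -[w ^+ N]powR_mulrn ?(ltW w_gt0) // -[N%:R](subrK t).
  rewrite powRD ?(gt_eqF w_gt0) ?implybT // ler_wpM2r ?powR_ge0 //.
have p_le n : (n <= k * n)%N by rewrite leq_pmull.
have xP l := @Zpadic_limit p (fun n => a n l) (fun n => side i k n l) p_pr
  (fun n => leq_trans (p_le n) (side_ge i k n l))
  (fun n => leq_trans (leq_addr k _) (side_step k i_ge0 n l)) (fun n => a_step n l).
have [x {}xP] := choice xP.
exists x.
  apply: (@BadZp_of_not_near R p N k) => // n near; apply: (a_near n).
  by apply: near_small_point_eqmod near => s; rewrite xP modn_mod.
move=> j in_ball; apply: (a_ball j) => l; rewrite -in_ball.
rewrite -(zp_res_mod (x l) (side_ge i k (d j) l)) xP modn_mod.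
by rewrite (modn_dvdm _ (dvdn_exp2l p (side_ge i k (d j) l))).
Qed.

(** * The two bounds on the Hausdorff dimension *)

(** Zero measure would give a cover so cheap that the balls around its members satisfy the
    hypothesis of [BadZp_avoids_balls]; the resulting point lies in the set but in no member of the
    cover. *)
Lemma hmeas_BadZp_neq0 (R : realType) (p N : nat) (i : 'I_N -> R) (s : R) :
  prime p -> (forall l, 0 <= i l) -> \sum_l i l = 1 -> 0 <= s -> s < N%:R ->
  hmeas (zpN_dist R p N) s (BadZp R p N i) <> 0%E.
Proof.
move=> p_pr i_ge0 sum_i s_ge0 lt_sN hmeas0.
(* [t] must stay below [N] for [BadZp_avoids_balls] and be positive even when [s = 0]. *)
pose t := (s + N%:R) / 2.
have [lt_st lt_tN] : s < t /\ t < N%:R by split; rewrite /t (midf_lt lt_sN).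
have t_gt0 : 0 < t by apply: le_lt_trans lt_st.
have [k [V [k_gt0 V_gt0 avoid]]] := BadZp_avoids_balls p_pr i_ge0 sum_i lt_tN.
pose K : R := (p%:R ^+ k) `^ t.
have K_gt0 : 0 < K by rewrite powR_gt0 // exprn_gt0 // ltr0n prime_gt0.
have VK_gt0 : 0 < (V * K)^-1 / 4 by rewrite divr_gt0 // invr_gt0 mulr_gt0.
have : (hmeas_delta (zpN_dist R p N) s 1 (BadZp R p N i) < ((V * K)^-1 / 4)%:E)%E.
  apply: (@le_lt_trans _ _ 0%E); last by rewrite lte_fin.
  by rewrite -hmeas0; apply: ereal_sup_ubound; exists 1 => //=; apply: ltr01.
move/ereal_inf_lt => [_ [U [coverU diamU] <-]] cost_lt.
(* The errors sum to [V^-1 / 4]; with the bound on the cost, the weighted series stays below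
   [1/4 + 1/4]. *)
pose e (j : nat) : R := (V^-1 / 4) / (2 ^ j.+1)%N%:R.
have e_gt0 j : 0 < e j by rewrite !divr_gt0 ?invr_gt0 // ltr0n expn_gt0.
have [bd bdP] := choice (fun j => set_in_ball p_pr k_gt0 (ltW lt_st) t_gt0 (e_gt0 j) (diamU j)).
have [|x xBad x_out] := avoid (fun j => (bd j).1) (fun j => (bd j).2); last first.
  by have [j _ Ujx] := coverU x xBad; apply: (x_out j); apply: (bdP j).1.
apply: (@le_lt_trans _ _ (V%:E * (K%:E * \sum_(0 <= j <oo) hcost (zpN_dist R p N) s (U j)
    + (V^-1 / 4)%:E))%E).
  under eq_eseriesr do rewrite EFinM.
  rewrite nneseriesZl; last by move=> *; rewrite lee_fin powR_ge0.
  rewrite lee_pmul2l ?lte_fin //.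
  rewrite -nneseriesZl; last by move=> *; apply: hcost_ge0.
  apply: le_trans (epsilon_trick xpredT _ _); last first.
  - by rewrite divr_ge0 ?invr_ge0 // ltW.
  - by move=> j; rewrite mule_ge0 ?hcost_ge0 // lee_fin ltW.
  apply: lee_nneseries => [j _ _|j _]; first by rewrite lee_fin powR_ge0.
  exact: (bdP j).2.
move: cost_lt; set S := (\sum_(0 <= _ <oo) _)%E.
have : (0 <= S)%E by apply: nneseries_ge0 => *; apply: hcost_ge0.
case: S => [S||] //; rewrite !lee_fin lte_fin => S_ge0 S_lt.
rewrite -EFinM lte_fin mulrDr mulrA.
have -> : V * (V^-1 / 4) = 4^-1 by field; rewrite gt_eqF.
have : V * K * S < 4^-1.
  by move: S_lt; rewrite -ltr_pdivlMl ?mulr_gt0 // mulrC.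
lra.
Qed.

(** The [p^(nN)] balls of radius [p^(-n)] cover the space at total cost at most [p^(-n(s-N))], which
    tends to 0. *)
Lemma hmeas_zpN_eq0 (R : realType) (p N : nat) (E : set ('I_N -> Zpadic p)) (s : R) :
  prime p -> N%:R < s -> hmeas (zpN_dist R p N) s E = 0%E.
Proof.
move=> p_pr lt_Ns.
have p_gt0 : 0 < p%:R :> R by rewrite ltr0n prime_gt0.
have s_ge0 : 0 <= s by apply: le_trans (ltW lt_Ns).
have delta_ge0 delta : (0 <= hmeas_delta (zpN_dist R p N) s delta E)%E.
  apply: le_ereal_inf_tmp => _ [U _ <-].
  by apply: nneseries_ge0 => j _ _; apply: hcost_ge0.
apply/eqP; rewrite eq_le; apply/andP; split; last first.
  apply: le_trans (delta_ge0 1) _; apply: ereal_sup_ubound; exists 1 => //=; exact: ltr01.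
apply: ge_ereal_sup => _ [delta /= delta_gt0 <-].
apply/lee_addgt0Pr => e e_gt0; rewrite add0e.
have sN_gt0 : 0 < s - N%:R by rewrite subr_gt0.
have [n1 n1P] := exprVn_powR_small (prime_gt1 p_pr) sN_gt0 e_gt0.
have [n2 n2P] := exprVn_powR_small (prime_gt1 p_pr) (@ltr01 R) delta_gt0.
(* [n1] makes the total cost at most [e], and [n2] the radius at most [delta]. *)
pose n := (n1 + n2)%N.
pose F := subbox (fun _ : 'I_N => p ^ n)%N.
pose U (j : nat) : set ('I_N -> Zpadic p) :=
  [set x | exists2 f : F, enum_rank f = j :> nat & forall l, zp_res (x l) n = f l].
have U_empty j : (#|F| <= j)%N -> U j = set0.
  move=> le_j; apply/seteqP; split=> // x [f fj _].
  by move: le_j; rewrite -fj leqNgt ltn_ord.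
have diamU j : (diam (zpN_dist R p N) (U j) <= (p%:R ^- n)%:E)%E.
  apply: ge_ereal_sup => _ [[x y] /= [[f fj xf] [g gj yg]] <-].
  rewrite lee_fin zpN_dist_le // => l; rewrite xf yg.
  suff -> : f = g by [].
  by apply: enum_rank_inj; apply: val_inj; rewrite /= fj gj.
have le_delta : p%:R ^- n <= delta.
  by have := n2P n (leq_addl _ _); rewrite powRr1 // invr_ge0 exprn_ge0.
apply: (@le_trans _ _ (\sum_(0 <= j <oo) hcost (zpN_dist R p N) s (U j))%E).
  apply: ereal_inf_lbound; exists U => //; split=> [x _|j]; last first.
    by apply: le_trans (diamU j) _; rewrite lee_fin.
  have lt_res l : (zp_res (x l) n < p ^ n)%N by case: (proj2_sig (x l) n).
  pose f : F := [ffun l => Ordinal (lt_res l)].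
  by exists (enum_rank f) => //; exists f => // l; rewrite ffunE.
rewrite (nneseries_split 0 #|F|); last by move=> *; apply: hcost_ge0.
rewrite add0n [X in (_ + X)%E]eseries0 ?adde0; last first.
  by move=> j le_j _; rewrite U_empty // /hcost asboolT.
apply: (@le_trans _ _ (\sum_(0 <= j < #|F|) ((p%:R ^- n) `^ s)%:E)%E).
  by apply: lee_sum => j _; apply: hcost_le.
have w_gt0 : 0 < p%:R ^- n :> R by rewrite invr_gt0 exprn_gt0.
have powE : (p%:R ^- n) `^ s = (p%:R ^- n) `^ (s - N%:R) * (p%:R ^- n) ^+ N :> R.
  by rewrite -(powR_mulrn _ (ltW w_gt0)) -powRD ?subrK // (gt_eqF w_gt0) implybT.
rewrite sumEFin lee_fin sumr_const_nat subn0 card_subbox prod_nat_const card_ord.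
rewrite -[leLHS]mulr_natr powE -mulrA !natrX exprVn mulVf ?mulr1 ?n1P ?leq_addr //.
by rewrite !expf_neq0 // gt_eqF.
Qed.

Theorem theorem10 (R : realType) (p N : nat) (i : 'I_N -> R) :
  prime p ->
  (forall s, 0 <= i s) ->
  \sum_(s < N) i s = 1 ->
  hdim R ('I_N -> Zpadic p) (zpN_dist R p N) (BadZp R p N i) = (N%:R)%:E.
Proof.
move=> p_pr i_ge0 sum_i; apply/eqP; rewrite eq_le; apply/andP; split.
  apply/lee_addgt0Pr => e e_gt0; rewrite -EFinD.
  apply: ereal_inf_lbound; exists (N%:R + e) => //; split; first by rewrite addr_ge0 // ltW.
  by apply: hmeas_zpN_eq0 => //; rewrite ltrDl.
apply: le_ereal_inf_tmp => _ [s [s_ge0 hmeas0] <-]; rewrite lee_fin leNgt.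
by apply/negP => lt_sN; apply: (@hmeas_BadZp_neq0 R p N i s).
Qed.
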